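(* Let $\lambda$ be a positive integer and let $\mathcal{K}$ denote the critical group of a doubly-regular tournament with parameters $(4\lambda+3,2\lambda+1,\lambda)$. Then $\mathcal{K}\cong \left(\mathbb{Z}/(\lambda+1)\mathbb{Z}\right)^{2\lambda+1}\oplus \mathcal{K}_{2}$, where $\mathcal{K}_{2}$ is a subgroup of $\mathcal{K}$ of order $(4\lambda+3)^{2\lambda}$.
   Context: A tournament is a directed graph obtained by orienting every edge of a complete graph. A doubly-regular tournament (DRT) with parameters $(n,k,\lambda)$ is a tournament on $n$ vertices in which every vertex dominates (has an arc to) exactly $k$ vertices and every pair of distinct vertices $v,w$ jointly dominates exactly $\lambda$ vertices (i.e. exactly $\lambda$ vertices $u$ have arcs $v\to u$ and $w\to u$). For a finite directed graph $\Gamma$ with vertex set $V$, let $\mathbb{Z}^V$ be the free abelian group on $V$, let $\Delta_v$ be the out-degree of $v$, and let $\nu_M:\mathbb{Z}^V\to\mathbb{Z}^V$ send $v$ to the sum of the vertices dominated by $v$. The Laplacian map is $\nu_Q(v)=\Delta_v v-\nu_M(v)$. The critical group of $\Gamma$ is the torsion (finite) subgroup of the cokernel $\mathbb{Z}^V/\nu_Q(\mathbb{Z}^V)$. *)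

(* Defs.v *)
From HB Require Import structures.
From mathcomp Require Import all_boot all_algebra.
From mathcomp Require Import boolp classical_sets functions cardinality.

Set Implicit Arguments.
Unset Strict Implicit.
Unset Printing Implicit Defensive.

Import GRing.Theory.
Local Open Scope ring_scope.

(* The subgroup S of U, as a group in its own right. *)
Record subgroup_of (U : zmodType) (S : zmodClosed U) := SubgroupOf {
  subgroup_val : U;
  _ : subgroup_val \in S
}.

Section SubgroupOf.
Variables (U : zmodType) (S : zmodClosed U).

HB.instance Definition _ := [isSub for @subgroup_val U S].
HB.instance Definition _ := [Choice of subgroup_of S by <:].
HB.instance Definition _ := [SubChoice_isSubZmodule of subgroup_of S by <:].

End SubgroupOf.

Definition group_iso (U W : zmodType) : Prop :=
  exists f : {additive U -> W}, bijective f.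

Definition torsion (U : zmodType) : {pred U} :=
  fun x => `[< exists n : nat, (0 < n)%N /\ x *+ n = 0 >].
Arguments torsion U : clear implicits.

Lemma torsion_zmod_closed (U : zmodType) : zmod_closed (torsion U).
Proof.
split=> [|x y /asboolP[m [m0 xm]] /asboolP[n [n0 yn]]].
  by apply/asboolP; exists 1%N.
apply/asboolP; exists (m * n)%N; rewrite muln_gt0 m0 n0; split=> //.
by rewrite mulrnBl mulrnA xm mul0rn mulnC mulrnA yn mul0rn subr0.
Qed.

HB.instance Definition _ (U : zmodType) :=
  GRing.isZmodClosed.Build U (torsion U) (torsion_zmod_closed U).

Definition im (U W : zmodType) (f : {additive U -> W}) : {pred W} :=
  fun y => `[< exists x, y = f x >].

Lemma im_zmod_closed (U W : zmodType) (f : {additive U -> W}) :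
  zmod_closed (im f).
Proof.
split=> [|_ _ /asboolP[x ->] /asboolP[y ->]]; apply/asboolP.
  by exists 0; rewrite raddf0.
by exists (x - y); rewrite raddfB.
Qed.

HB.instance Definition _ (U W : zmodType) (f : {additive U -> W}) :=
  GRing.isZmodClosed.Build W (im f) (im_zmod_closed f).

Definition coker (U W : zmodType) (f : {additive U -> W}) : zmodType :=
  Quotient.quot (im f).

Section FreeGroup.
Variable V : finType.

(* Z^V is {ffun V -> int}; vertex v is the basis element v. *)
Definition vertex (v : V) : {ffun V -> int} := [ffun w => (w == v)%:R].

(* The homomorphism defined on Z^V by the images g v of the basis elements. *)
Definition free_hom (U : zmodType) (g : V -> U) (x : {ffun V -> int}) : U :=
  \sum_v g v *~ x v.

Lemma free_hom_is_zmod_morphism (U : zmodType) (g : V -> U) :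
  zmod_morphism (free_hom g).
Proof.
by move=> x y; rewrite -sumrB; apply: eq_bigr => v _; rewrite !ffunE mulrzBr.
Qed.

HB.instance Definition _ (U : zmodType) (g : V -> U) :=
  GRing.isZmodMorphism.Build {ffun V -> int} U (free_hom g)
    (free_hom_is_zmod_morphism g).

End FreeGroup.

(* A finite directed graph is e : rel V on V : finType; e v w means that
   there is an arc v -> w, i.e. that v dominates w. *)
Section Digraph.
Variables (V : finType) (e : rel V).

Definition outdeg (v : V) : nat := #|[set w | e v w]|.

Definition nu_M : {additive {ffun V -> int} -> {ffun V -> int}} :=
  free_hom (fun v => \sum_(w | e v w) vertex w).

Definition nu_Q : {additive {ffun V -> int} -> {ffun V -> int}} :=
  free_hom (fun v => vertex v *+ outdeg v - nu_M (vertex v)).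

Definition critical_group : zmodType := subgroup_of (torsion (coker nu_Q)).

Definition tournament : Prop :=
  irreflexive e /\ forall v w, v != w -> e v w (+) e w v.

Definition doubly_regular_tournament (n k lambda : nat) : Prop :=
  [/\ tournament, #|V| = n,
      forall v, outdeg v = k &
      forall v w, v != w -> #|[set u | e v u && e w u]| = lambda].

End Digraph.

(* Main.v *)
(* Write n = 4 lambda + 3, m = lambda + 1, k = 2 lambda + 1, and let A be the
   adjacency matrix, J the all-ones matrix and Q = k - A.  Double regularity
   gives Q J = J Q = 0, Q (n - Q) = m (n - J) and n - Q = Q^T + J.  Let d_i be
   the diagonal of a Smith form of Q; exactly one of them is zero, and the
   critical group is the sum of the Z/d_i over the others.  The quadratic
   equation shows that each d_i divides m n, and that m divides
   d_i (n - c_i d_i) for some c_i; since m and n are coprime, gcd(m, d_i) is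
   therefore a unitary divisor of m.  Evaluating det (Q + J)^2 in two ways
   gives (prod d_i) n = (m n)^k.  As the d_i form a divisibility chain of
   length 2 k, the first k of them must be prime to m and the last k divisible
   by m, so the m-part is (Z/m)^k, and K_2 is the n-torsion, of order
   n^(k - 1) = n^(2 lambda). *)
From HB Require Import structures.
Require Import Defs.
From mathcomp Require Import all_boot all_algebra.
From mathcomp Require Import boolp classical_sets functions cardinality.
From mathcomp Require Import zify ring.

Set Implicit Arguments.
Unset Strict Implicit.
Unset Printing Implicit Defensive.

Import GRing.Theory Num.Theory.

Local Open Scope ring_scope.

(** * Arithmetic of divisibility chains *)

Lemma coprime_prodr (I : finType) (P : pred I) (f : I -> nat) (m : nat) :
  (forall i, P i -> coprime m (f i)) -> coprime m (\prod_(i | P i) f i).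
Proof.
move=> mf; elim/big_rec: _ => [|i x Pi mx]; first exact: coprimen1.
by rewrite coprimeMr mf.
Qed.

(** The factors other than [g i] multiply to a divisor of [m ^ k.-1], so [m ^ k] divides
    [g i * m ^ k.-1] and [m <= g i]. *)
Lemma prod_dvd_eq (k m : nat) (g : 'I_k -> nat) :
  (0 < m)%N -> (forall i, g i %| m)%N -> (m ^ k %| \prod_i g i)%N ->
  forall i, g i = m.
Proof.
move=> m0 gm mg i.
have g0 j : (0 < g j)%N by apply: dvdn_gt0 (gm j).
apply/eqP; rewrite eqn_leq dvdn_leq //=.
move: mg; rewrite (bigD1 i) //= => mg.
have h : (\prod_(j | j != i) g j %| m ^ k.-1)%N.
  have -> : (m ^ k.-1 = \prod_(j : 'I_k | j != i) m)%N.
    by rewrite prod_nat_const cardC1 card_ord.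
  by elim/big_ind2: _ => // a b c d ab cd; apply: dvdn_mul.
have k0 : (0 < k)%N by apply: leq_ltn_trans (ltn_ord i).
have p0 : (0 < m ^ k.-1)%N by rewrite expn_gt0 m0.
have := dvdn_trans mg (dvdn_mul (dvdnn (g i)) h).
rewrite -{1}(prednK k0) expnS => /dvdn_leq.
by rewrite muln_gt0 g0 p0 => /(_ isT); rewrite leq_pmul2r.
Qed.

(** With [g] the gcd and [q = m / g], [q] is prime to [d / g] and hence divides [n - c * d]. A
    common divisor of [g] and [q] then divides [d], [n] and [m], so it is 1. *)
Lemma unitary_gcd (m n d : nat) (c : int) :
  (0 < m)%N -> coprime m n -> (m %| d%:Z * (n%:Z - c * d%:Z))%Z ->
  coprime (gcdn m d) (m %/ gcdn m d).
Proof.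
move=> m0 mn md; set g := gcdn m d.
have g0 : (0 < g)%N by rewrite gcdn_gt0 m0.
have dE : d = (g * (d %/ g))%N by rewrite mulnC divnK ?dvdn_gcdr.
have mE : m = (g * (m %/ g))%N by rewrite mulnC divnK ?dvdn_gcdl.
have qd : coprime (m %/ g) (d %/ g).
  by rewrite /coprime -(eqn_pmul2l g0) muln_gcdr -mE -dE muln1.
have qn : ((m %/ g)%:Z %| n%:Z - c * d%:Z)%Z.
  rewrite -(@Gauss_dvdzr _ (d %/ g)%:Z); last by rewrite coprimezE.
  rewrite -(@dvdz_mul2l g%:Z); last by rewrite eqz_nat -lt0n.
  by rewrite mulrA -!PoszM -mE -dE.
set q := (m %/ g)%N in mE qn *; set t := gcdn g q.
have td : (t%:Z %| d%:Z)%Z.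
  by rewrite dvdzE /= (dvdn_trans (dvdn_gcdl _ _)) ?dvdn_gcdr.
have tn : (t%:Z %| n%:Z)%Z.
  rewrite -(subrK (c * d%:Z) n%:Z) rpredD ?dvdz_mull //.
  by apply: dvdz_trans qn; rewrite dvdzE dvdn_gcdr.
have tm : (t %| m)%N by rewrite mE dvdn_mulr ?dvdn_gcdl.
by rewrite /coprime -dvdn1 -(eqP mn) dvdn_gcd tm; rewrite dvdzE /= in tn.
Qed.

(** Each [f i] factors as [g i * b i], its gcds with [m] and [n]. The product formula leaves room
    for only [k.+1] factors [m], which the chain and unitarity push into the right half. *)
Lemma split_dvd_chain (k m n : nat) (f : 'I_(k.+1 + k.+1) -> nat)
    (c : 'I_(k.+1 + k.+1) -> int) :
  (0 < m)%N -> (0 < n)%N -> coprime m n ->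
  (forall i j : 'I_(k.+1 + k.+1), (i <= j)%N -> f i %| f j)%N ->
  (forall i, f i %| m * n)%N ->
  (forall i, (m %| (f i)%:Z * (n%:Z - c i * (f i)%:Z))%Z) ->
  (\prod_i f i * n = (m * n) ^ k.+1)%N ->
  [/\ forall i : 'I_k.+1, (f (lshift _ i) %| n)%N,
      forall i : 'I_k.+1, (f (rshift _ i) = m * gcdn (f (rshift _ i)) n)%N &
      ((\prod_(i < k.+1) f (lshift _ i)) *
        \prod_(i < k.+1) gcdn (f (rshift _ i)) n = n ^ k)%N].
Proof.
move=> m0 n0 mn fle fmn fu fP.
pose g i := gcdn m (f i); pose b i := gcdn (f i) n.
have gb i : coprime (g i) (b i).
  by apply: coprime_dvdl (dvdn_gcdl _ _) (coprime_dvdr (dvdn_gcdr _ _) mn).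
have fE i : f i = (g i * b i)%N.
  apply/eqP; rewrite eqn_dvd; apply/andP; split; last first.
    by rewrite Gauss_dvd // dvdn_gcdr dvdn_gcdl.
  rewrite /g /b muln_gcdr !muln_gcdl !dvdn_gcd fmn.
  by rewrite dvdn_mull // !dvdn_mulr.
have gn i : coprime (g i) n by apply: coprime_dvdl (dvdn_gcdl _ _) mn.
have bm i : coprime m (b i) by apply: coprime_dvdr (dvdn_gcdr _ _) mn.
pose i0 : 'I_(k.+1 + k.+1) := lshift k.+1 ord_max.
have g1 : g i0 = 1%N.
  have gi0 (i : 'I_(k.+1 + k.+1)) : (i0 <= i)%N -> (g i0 %| f i)%N.
    by move=> ii; apply: dvdn_trans (dvdn_gcdr _ _) (fle _ _ ii).
  (* [g i0] divides [f i0] and all [k.+1] entries of the right half: one factor more than the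
     exponent of [m]. Cancelling leaves [g i0] dividing a power of its coprime cofactor
     [m / g i0]. *)
  have : (g i0 ^ k.+2 %| m ^ k.+1)%N.
    rewrite -(@Gauss_dvdl _ _ (n ^ k.+1)); last first.
      by rewrite coprimeXl // coprimeXr.
    rewrite -expnMn -fP dvdn_mulr // big_split_ord /= expnS.
    apply: dvdn_mul; first by rewrite (bigD1 ord_max) //= dvdn_mulr // gi0.
    have -> : (g i0 ^ k.+1 = \prod_(j < k.+1) g i0)%N.
      by rewrite prod_nat_const card_ord.
    elim/big_ind2: _ => // [x y z t|i _]; first exact: dvdn_mul.
    by apply: gi0; rewrite /= addSn leqW // leq_addr.
  have g0 : (0 < g i0)%N by rewrite gcdn_gt0 m0.
  have mE : m = (g i0 * (m %/ g i0))%N by rewrite mulnC divnK ?dvdn_gcdl.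
  rewrite {1}mE expnMn expnSr dvdn_pmul2l ?expn_gt0 ?g0 // => gq.
  have /eqP <- : coprime (g i0) ((m %/ g i0) ^ k.+1).
    by rewrite coprimeXr // (unitary_gcd m0 mn (fu i0)).
  by rewrite (gcdn_idPl gq).
have fl (i : 'I_k.+1) : coprime m (f (lshift _ i)).
  have : (f (lshift k.+1 i) %| f i0)%N by apply: fle; rewrite /= -ltnS.
  move=> /coprime_dvdr; apply; rewrite /coprime -/(g i0) g1 //.
(* The left half and all [b i] are prime to [m], so [m ^ k.+1] divides the product of the [k.+1]
   right-hand [g i], each a divisor of [m]. *)
have fr (i : 'I_k.+1) : g (rshift _ i) = m.
  move: i; apply: prod_dvd_eq => // [i|]; first exact: dvdn_gcdl.
  have : (m ^ k.+1 %| \prod_i f i * n)%N by rewrite fP expnMn dvdn_mulr.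
  rewrite Gauss_dvdl ?coprimeXl // big_split_ord /= Gauss_dvdr; last first.
    by rewrite coprimeXl // coprime_prodr.
  have -> : (\prod_(i < k.+1) f (rshift k.+1 i) =
      \prod_(i < k.+1) g (rshift k.+1 i) * \prod_(i < k.+1) b (rshift k.+1
        i))%N.
    by rewrite -big_split /=; apply: eq_bigr => i _; rewrite fE.
  by rewrite Gauss_dvdl // coprimeXl // coprime_prodr.
split=> [i|i|].
- by have := fmn (lshift k.+1 i); rewrite Gauss_dvdr // coprime_sym.
- by rewrite {1}fE fr.
move: fP; rewrite big_split_ord /=.
have -> : (\prod_(i < k.+1) f (rshift k.+1 i) =
    m ^ k.+1 * \prod_(i < k.+1) b (rshift k.+1 i))%N.
  have -> : (m ^ k.+1 = \prod_(j < k.+1) m)%N.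
    by rewrite prod_nat_const card_ord.
  by rewrite -big_split /=; apply: eq_bigr => i _; rewrite {1}fE fr.
rewrite mulnCA -mulnA expnMn => /eqP.
by rewrite eqn_pmul2l ?expn_gt0 ?m0 // expnSr eqn_pmul2r // => /eqP.
Qed.

(** Two block eliminations of the bordered matrix [P] evaluate its determinant. The factor [a] on
    the left avoids dividing by [a]. *)
Lemma det_scalar_add_rank1 (R : comPzRingType) (n : nat) (a : R)
    (u : 'cV[R]_n) (w : 'rV[R]_n) :
  a * \det (a%:M + u *m w) = a ^+ n * (a + (w *m u) 0 0).
Proof.
pose P : 'M[R]_(n + 1) := block_mx a%:M (- u) w 1%:M.
have d1 : \det P = \det (a%:M + u *m w).
  have : \det (P *m block_mx 1%:M 0 (- w) 1%:M) = \det (a%:M + u *m w).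
    rewrite mulmx_block !mulmx1 !mulmx0 !mul1mx mulNmx mulmxN opprK subrr add0r.
    by rewrite !add0r det_ublock det1 mulr1.
  by rewrite det_mulmx det_lblock !det1 !mulr1.
have : \det (block_mx 1%:M 0 (- w) a%:M *m P) = a ^+ n * (a + (w *m u) 0 0).
  rewrite mulmx_block !mul1mx !mul0mx !addr0 mul_mx_scalar mul_scalar_mx.
  rewrite scalerN addNr mulmxN mulNmx opprK mulmx1 det_ublock det_scalar
    det_mx11.
  by rewrite !mxE /= mulr1n addrC.
by rewrite det_mulmx det_lblock det1 mul1r det_scalar1 d1.
Qed.

Lemma scalemx_int_eq0 (p q : nat) (a : int) (A : 'M_(p, q)) :
  a != 0 -> a *: A = 0 -> A = 0.
Proof.
move=> a0 /matrixP aA; apply/matrixP => i j; apply: (mulfI a0).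
by have := aA i j; rewrite !mxE mulr0.
Qed.

(** * Smith form of the Laplacian matrix *)

Section LaplacianSmith.

Variables (N m : nat) (Q L R : 'M[int]_N.+1) (d : 'rV[int]_N.+1).

Local Notation one := (const_mx 1 : 'rV[int]_N.+1).
Local Notation J := (one^T *m one).
Local Notation n := (N.+1%:R : int).
Local Notation e := (delta_mx 0 ord_max : 'rV[int]_N.+1).

Hypothesis m_gt0 : (0 < m)%N.
Hypothesis one_Q : one *m Q = 0.
Hypothesis Q_one : Q *m one^T = 0.
Hypothesis Q_quad : Q *m (n%:M - Q) = m%:R *: (n%:M - J).
Hypothesis Q_tr : Q^T = n%:M - Q - J.
Hypothesis QE : Q = L *m diag_mx d *m R.
Hypothesis L_unit : L \in unitmx.
Hypothesis R_unit : R \in unitmx.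
Hypothesis d_chain : forall i j : 'I_N.+1, (i <= j)%N -> (d 0%R i %| d 0%R j)%Z.

Let n_neq0 : n != 0. Proof. by rewrite pnatr_eq0. Qed.
Let m_neq0 : m%:R != 0 :> int. Proof. by rewrite pnatr_eq0 -lt0n. Qed.

Lemma one_mul_one_tr : (one *m one^T) 0 0 = n.
Proof.
rewrite mxE (eq_bigr (fun=> 1)) => [|i _]; last by rewrite !mxE mulr1.
by rewrite sumr_const card_ord.
Qed.

Lemma smith_last_eq0 : d 0 ord_max = 0.
Proof.
have detQ : \det Q = 0.
  have : one *m Q *m \adj Q = 0 by rewrite one_Q mul0mx.
  rewrite -mulmxA mul_mx_adj mul_mx_scalar => /matrixP/(_ 0 0).
  by rewrite !mxE mulr1.
move: detQ; rewrite QE !det_mulmx det_diag => /eqP.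
rewrite !mulf_eq0 => /orP[/orP[|]|].
- by move=> /eqP h; move: L_unit; rewrite unitmxE h unitr0.
- case/prodf_eq0 => i _ /eqP di.
  by have := d_chain (leq_ord i : (i <= @ord_max N)%N);
    rewrite di dvd0z => /eqP.
- by move=> /eqP h; move: R_unit; rewrite unitmxE h unitr0.
Qed.

(** Multiplying [y *m Q = 0] by [n - Q] and cancelling [m] leaves [y *m (n - J) = 0]. *)
Lemma laplacian_ker (y : 'rV[int]_N.+1) :
  y *m Q = 0 -> n *: y = (y *m one^T) 0 0 *: one.
Proof.
move=> yQ; have : y *m Q *m (n%:M - Q) = 0 by rewrite yQ mul0mx.
rewrite -mulmxA Q_quad -scalemxAr => /(scalemx_int_eq0 m_neq0)/eqP.
rewrite mulmxBr mul_mx_scalar mulmxA subr_eq0 => /eqP ->.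
by rewrite {1}[y *m _]mx11_scalar mul_scalar_mx.
Qed.

Lemma smith_eq0_row (i : 'I_N.+1) :
  d 0 i = 0 -> exists s : int, n *: delta_mx 0 i = s *: (one *m L).
Proof.
move=> di; pose y : 'rV[int]_N.+1 := delta_mx 0 i *m invmx L.
exists ((y *m one^T) 0 0); rewrite scalemxAl -laplacian_ker.
  by rewrite -scalemxAl mulmxKV.
rewrite QE !mulmxA mulmxKV // -rowE row_diag_mx di.
by rewrite scale0r mul0mx.
Qed.

(* Two zero diagonal entries would give two independent vectors in the kernel
   of [Q], which is spanned by [one]. *)
Lemma smith_neq0 (i : 'I_N.+1) : i != ord_max -> d 0 i != 0.
Proof.
move=> iN; apply/eqP => /smith_eq0_row[s /matrixP hs].
have [t /matrixP ht] := smith_eq0_row smith_last_eq0.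
have:= hs 0 i; have := ht 0 i; have := ht 0 ord_max.
rewrite ![_ (_ *: _) _ _]mxE ![(delta_mx _ _) _ _]mxE !eqxx /= (negPf iN) mulr0
  !mulr1.
set x := fun_of_matrix _ _ _; set y := fun_of_matrix _ _ _.
move=> n1 ty n2; have t0 : t != 0.
  by apply/eqP => h; move: n_neq0; rewrite n1 h mul0r eqxx.
have y0 : y = 0 by apply/eqP; move/eqP: (esym ty); rewrite mulf_eq0 (negPf t0).
by move: n_neq0; rewrite n2 y0 mulr0 eqxx.
Qed.

(** Since [one *m Q = 0], [one *m L] is killed by the diagonal matrix, whose only zero entry is the
    last. As [one] has entries 1 and [L] is invertible, [c] is a unit; [c * c = 1] records a
    sign. *)
Lemma one_mul_L : exists2 c : int, c * c = 1 & one *m L = c *: e.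
Proof.
have oL : one *m L = (one *m L) 0 ord_max *: e.
  have : one *m L *m diag_mx d = 0.
    by apply: (can_inj (mulmxK R_unit));
      rewrite mul0mx -!mulmxA (mulmxA L) -QE one_Q.
  move=> h; apply/matrixP => a j; rewrite ord1 [RHS]mxE [e _ _]mxE eqxx /=.
  have [->|jN] := eqVneq j ord_max; first by rewrite mulr1.
  move/matrixP/(_ 0 j): h; rewrite mul_mx_diag !mxE => /eqP.
  rewrite mulr0 mulf_eq0 (negPf (smith_neq0 jN)) orbF => /eqP //.
set c := fun_of_matrix _ _ _ in oL; exists c => //.
have : c * (e *m invmx L) 0 0 = 1.
  have : one = c *: (e *m invmx L) by rewrite scalemxAl -oL mulmxK.
  by move/matrixP/(_ 0 0); rewrite [LHS]mxE [RHS]mxE.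
rewrite mulrC => /intUnitRing.unitzPl; rewrite qualifE /=.
by case/orP=> /eqP->; rewrite ?mulrNN mulr1.
Qed.

Lemma R_mul_one : exists2 c : int, c * c = 1 & R *m one^T = c *: e^T.
Proof.
have oR : R *m one^T = (R *m one^T) ord_max 0 *: e^T.
  have : diag_mx d *m (R *m one^T) = 0.
    by apply: (can_inj (mulKmx L_unit)); rewrite mulmx0 !mulmxA -QE.
  move=> h; apply/matrixP => j a; rewrite ord1 [RHS]mxE [e^T _ _]mxE [e _ _]mxE
    /=.
  have [->|jN] := eqVneq j ord_max; first by rewrite mulr1.
  move/matrixP/(_ j 0): h; rewrite mul_diag_mx [LHS]mxE [RHS]mxE => /eqP.
  by rewrite mulr0 mulf_eq0 (negPf (smith_neq0 jN)) => /eqP.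
set c := fun_of_matrix _ _ _ in oR; exists c => //.
have : c * (invmx R *m e^T) 0 0 = 1.
  have : one^T = c *: (invmx R *m e^T) by rewrite scalemxAr -oR mulKmx.
  by move/matrixP/(_ 0 0); rewrite [LHS]mxE mxE [RHS]mxE.
rewrite mulrC => /intUnitRing.unitzPl; rewrite qualifE /=.
by case/orP=> /eqP->; rewrite ?mulrNN mulr1.
Qed.

(** The transpose of [Q + J] is [n - Q], so the square is the determinant of [(Q + J) *m (n - Q)],
    which is [m n] plus [(n - m) J]. The rank one formula applies, with
    [m n + (n - m) n = n ^ 2]. *)
Lemma det_add_J_sqr : \det (Q + J) ^+ 2 = (m%:R * n) ^+ N * n ^+ 2.
Proof.
have JJ : J *m J = n *: J.
  rewrite mulmxA -(mulmxA _ one) [one *m _]mx11_scalar one_mul_one_tr.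
  by rewrite mul_mx_scalar -scalemxAl.
have JQ : J *m Q = 0 by rewrite -mulmxA one_Q mulmx0.
have -> : \det (Q + J) ^+ 2 =
    \det ((m%:R * n)%:M + one^T *m ((n - m%:R) *: one)).
  have QJ : (Q + J)^T = n%:M - Q.
    by rewrite linearD /= trmx_mul trmxK Q_tr; apply: subrK.
  rewrite expr2 -{2}det_tr QJ -det_mulmx.
  congr (\det _); rewrite mulmxDl Q_quad mulmxBr JQ subr0 mul_mx_scalar.
  rewrite scalerBr scale_scalar_mx -scalemxAr scalerBl.
  by rewrite addrAC -addrA.
apply: (mulfI (mulf_neq0 m_neq0 n_neq0)).
rewrite det_scalar_add_rank1 -scalemxAl mxE one_mul_one_tr.
rewrite mulrBl addrCA subrr addr0 exprS expr2; ring.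
Qed.

(** As the last entry of [d] is 0, the determinant of [diag_mx d + u *m w] is the product of the
    other entries times the last coordinates of [u] and [w], each of which is [n] up to sign. *)
Lemma det_add_J :
  exists2 c : int, c * c = 1 &
    \det (Q + J) = c * n ^+ 2 * \prod_(i < N) d 0 (lift ord_max i).
Proof.
have [c cc oL] := one_mul_L; have [c' cc' oR] := R_mul_one.
pose u := invmx L *m one^T; pose w := one *m invmx R.
have eu : (e *m u) 0 0 = c * n.
  have : c *: (e *m u) = one *m one^T by rewrite scalemxAl -oL mulmxA mulmxK.
  by move/matrixP/(_ 0 0); rewrite one_mul_one_tr mxE => <-;
    rewrite mulrA cc mul1r.
have we : (w *m e^T) 0 0 = c' * n.
  have : c' *: (w *m e^T) = one *m one^T.
    by rewrite scalemxAr -oR mulmxA mulmxKV.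
  by move/matrixP/(_ 0 0); rewrite one_mul_one_tr mxE => <-;
    rewrite mulrA cc' mul1r.
have Lu : L *m u = one^T by rewrite mulKVmx.
have wR : w *m R = one by rewrite mulmxKV.
clearbody u w.
(* In a Smith form of [Q], [J] becomes [u *m w]; the factorisation below writes
   [diag_mx d + u *m w] as a product of rank one perturbations of the identity
   and of a diagonal matrix. *)
have ee : e *m e^T = 1%:M.
  by rewrite trmx_delta mul_delta_mx; apply/matrixP => a b; rewrite !mxE !ord1.
have -> : Q + J = L *m ((1%:M + (u - e^T) *m e) *m diag_mx (d + e)
    *m (1%:M + e^T *m (w - e))) *m R.
  have -> : diag_mx (d + e) = diag_mx d + e^T *m e.
    rewrite raddfD; congr (_ + _); rewrite trmx_delta mul_delta_mx.
    by apply/matrixP => a b; rewrite !mxE /=; do ![case: eqP => //=] => *;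
      subst.
  have eD : e *m diag_mx d = 0 by rewrite -rowE row_diag_mx smith_last_eq0
    scale0r.
  have De : diag_mx d *m e^T = 0.
    by apply: trmx_inj; rewrite trmx_mul trmxK tr_diag_mx eD trmx0.
  have -> : (1%:M + (u - e^T) *m e) *m (diag_mx d + e^T *m e) = diag_mx d + u
    *m e.
    rewrite mulmxDl mul1mx mulmxDr -!mulmxA eD mulmx0 add0r (mulmxA e) ee
      mul1mx.
    by rewrite mulmxBl -addrA subrKC.
  have -> : (diag_mx d + u *m e) *m (1%:M + e^T *m (w - e)) = diag_mx d + u *m
    w.
    rewrite mulmxDr mulmx1 mulmxDl !mulmxA De mul0mx add0r.
    rewrite -(mulmxA u e) ee mulmx1 mulmxBr.
    by rewrite -addrA subrKC.
  by rewrite mulmxDr mulmxDl QE !mulmxA Lu -(mulmxA _ w) wR.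
have dL : \det L * \det L = 1.
  by move: L_unit; rewrite unitmxE => /orP[]/eqP->; rewrite ?mulrNN mulr1.
have dR : \det R * \det R = 1.
  by move: R_unit; rewrite unitmxE => /orP[]/eqP->; rewrite ?mulrNN mulr1.
have det1D (x : 'cV[int]_N.+1) (y : 'rV[int]_N.+1) :
    \det (1%:M + x *m y) = 1 + (y *m x) 0 0.
  by rewrite -[LHS]mul1r det_scalar_add_rank1 expr1n mul1r.
exists (\det L * \det R * c * c').
  transitivity ((\det L * \det L) * (\det R * \det R) * (c * c) * (c' * c')).
    by ring.
  by rewrite dL dR cc cc' !mulr1.
rewrite !det_mulmx !det1D mulmxBr mulmxBl ee det_diag.
have sub1 (X : 'M[int]_1) : 1 + (X - 1%:M) 0 0 = X 0 0.
  by rewrite !mxE /= addrCA subrr addr0.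
rewrite !sub1 eu we (bigD1_ord ord_max) //= mxE smith_last_eq0 mxE !eqxx add0r.
under eq_bigr => i _ do
  rewrite mxE [e _ _]mxE [lift _ _ == _]eq_sym (negPf (neq_lift _ _)) addr0.
by rewrite mul1r; ring.
Qed.

(** Squaring removes the unknown sign in [det_add_J]; comparing with [det_add_J_sqr], a factor
    [n ^+ 2] cancels. *)
Lemma prod_smith_sqr :
  (\prod_(i < N) d 0 (lift ord_max i)) ^+ 2 * n ^+ 2 = (m%:R * n) ^+ N.
Proof.
have [c cc dE] := det_add_J; apply: (mulfI (expf_neq0 2 n_neq0)).
rewrite [RHS]mulrC -det_add_J_sqr dE; set P := \prod_(i < N) _.
by rewrite -[LHS]mul1r -cc; ring.
Qed.

(** Conjugating [(n - Q) *m Q = m (n - J)] by [R] turns the [J] term into a matrix supported on the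
    last row. Every other diagonal entry then writes [m n] as a multiple of [d_j]. *)
Lemma smith_dvd (i : 'I_N) : (d 0%R (lift ord_max i) %| m%:R * n)%Z.
Proof.
have [c _ oR] := R_mul_one; set j := lift ord_max i.
have jN : (j == ord_max) = false by rewrite eq_sym (negPf (neq_lift _ _)).
have nQ : (n%:M - Q) *m Q = m%:R *: (n%:M - J).
  by rewrite -Q_quad mulmxBl mulmxBr mul_mx_scalar mul_scalar_mx.
have : R *m (n%:M - Q) *m L *m diag_mx d =
    (m%:R * n)%:M - m%:R *: (c *: (e^T *m (one *m invmx R))).
  apply: (can_inj (mulmxK R_unit)).
  transitivity (R *m (m%:R *: (n%:M - J))); first by rewrite -nQ QE !mulmxA.
  rewrite -scalemxAr mulmxBr mul_mx_scalar (mulmxA R) oR -scalemxAl.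
  rewrite mulmxBl mul_scalar_mx -!scalemxAl -(mulmxA e^T) mulmxKV //.
  by rewrite scalerBr !scalerA.
set X := R *m _ *m L => /matrixP/(_ j j); rewrite mul_mx_diag mxE => XE.
apply/dvdzP; exists (X j j); rewrite XE !mxE eqxx mulr1n big1 ?mulr0 ?subr0 //.
by move=> k _; rewrite !mxE jN andbF mul0r.
Qed.

(** Stripping [L] and [R] from [Q *m (n - Q)] leaves [D *m (n - B *m D)] with [B = R *m L] and
    [D = diag_mx d]; the witness is a diagonal entry of [B]. *)
Lemma smith_unitary (i : 'I_N) : exists c : int,
  (m%:R %| d 0%R (lift ord_max i) * (n - c * d 0%R (lift ord_max i)))%Z.
Proof.
pose B := R *m L; set j := lift ord_max i; exists (B j j).
have : diag_mx d *m (n%:M - B *m diag_mx d) =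
    m%:R *: (invmx L *m (n%:M - J) *m invmx R).
  apply: (can_inj (mulKmx L_unit)); apply: (can_inj (mulmxK R_unit)).
  rewrite -scalemxAr -scalemxAl -!(mulmxA (invmx L)) mulKVmx // mulmxKV //.
  rewrite -Q_quad mulmxBr mulmxBr mulmxBl !mulmxBr.
  rewrite mul_mx_scalar -scalemxAr -scalemxAl mul_mx_scalar -QE /B.
  by rewrite [in Q *m Q]QE !mulmxA.
set X := invmx L *m _ *m _; clearbody B X => /matrixP/(_ j j).
rewrite mul_mx_diag mul_diag_mx !mxE eqxx mulr1n => XE.
by apply/dvdzP; exists (X j j); rewrite [RHS]mulrC -XE.
Qed.

End LaplacianSmith.

(** * Groups given by integer coordinates, and the splitting of their torsion *)

Lemma intr_Zp_eq0 (m : nat) (z : int) :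
  (1 < m)%N -> (z%:~R == 0 :> 'Z_m) = (m %| z)%Z.
Proof.
move=> m1; have m0 : m%:R = 0 :> 'Z_m by rewrite pchar_Zp.
apply/eqP/idP => [|/dvdzP[q ->]]; last by rewrite intrM -pmulrn m0 mulr0.
rewrite {1}(divz_eq z m) intrD intrM -pmulrn m0 mulr0 add0r => z0.
apply/dvdz_mod0P; move: z0; have : (0 <= (z %% m)%Z) by rewrite modz_ge0 //;
  lia.
have : ((z %% m)%Z < m%:Z) by rewrite ltz_pmod //; lia.
case: (z %% m)%Z => // r; rewrite ltz_nat => rm _ /(congr1 (@nat_of_ord _)).
by rewrite -pmulrn val_Zp_nat // modn_small //= => ->.
Qed.

Definition torsion_by (K : zmodType) (n : nat) : {pred K} :=
  fun x => x *+ n == 0.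

Lemma torsion_by_zmod_closed (K : zmodType) (n : nat) :
  zmod_closed (@torsion_by K n).
Proof.
split=> [|x y]; first by rewrite /in_mem /= /torsion_by mul0rn.
rewrite /in_mem /= /torsion_by => /eqP x0 /eqP y0.
by rewrite mulrnBl x0 y0 subrr.
Qed.

HB.instance Definition _ (K : zmodType) (n : nat) :=
  GRing.isZmodClosed.Build K (@torsion_by K n) (torsion_by_zmod_closed K n).

Section Coordinates.

(* [cl x i] is the component of [x] in the i-th factor of [\bigoplus_i Z/d_i],
   lifted to an integer; hence [cl] is only additive modulo [d]. *)
Variables (K : zmodType) (k l m n s : nat).
Variables (cl : K -> 'I_(k + l) -> int) (d h g : 'I_(k + l) -> nat).

Hypothesis clB : forall x y i, (d i %| cl (x - y) i - (cl x i - cl y i))%Z.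
Hypothesis cl_eq0 : forall x, (forall i, (d i %| cl x i)%Z) -> x = 0.
Hypothesis cl_surj :
  forall y : 'I_(k + l) -> int, exists x, forall i, (d i %| cl x i - y i)%Z.
Hypothesis m_gt1 : (1 < m)%N.
Hypothesis smn : (s * m = n.+1)%N.
Hypothesis n_gt0 : (0 < n)%N.
Hypothesis dE : forall i, d i = (h i * g i)%N.
Hypothesis hl : forall i : 'I_k, h (lshift l i) = 1%N.
Hypothesis hr : forall i : 'I_l, h (rshift k i) = m.
Hypothesis g_dvd : forall i, (g i %| n)%N.

Let mn : coprime m n.
Proof. by rewrite coprime_sym (coprime_dvdr _ (coprimenS n)) // -smn dvdn_mull.
  Qed.

Let m_gt0 : (0 < m)%N. Proof. exact: ltnW. Qed.

Let h_dvd i : (h i %| m)%N.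
Proof. by case: (split_ordP i) => j ->; rewrite ?hl ?hr. Qed.

Let h_gt0 i : (0 < h i)%N. Proof. exact: dvdn_gt0 (h_dvd i). Qed.

Let g_gt0 i : (0 < g i)%N. Proof. exact: dvdn_gt0 (g_dvd i). Qed.

Let hdvd_d i : (h i %| (d i)%:Z)%Z. Proof. by rewrite dE PoszM dvdz_mulr. Qed.

Lemma cl_0 i : (d i %| cl 0 i)%Z.
Proof. by have := clB 0 0 i; rewrite !subrr subr0. Qed.

Lemma clN x i : (d i %| cl (- x) i + cl x i)%Z.
Proof.
have := clB 0 x i; rewrite sub0r => h1.
have -> : cl (- x) i + cl x i = (cl (- x) i - (cl 0 i - cl x i)) + cl 0 i by
  ring.
by rewrite rpredD // cl_0.
Qed.

Lemma clD x y i : (d i %| cl (x + y) i - (cl x i + cl y i))%Z.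
Proof.
have := clB x (- y) i; rewrite opprK => h1; have h2 := clN y i.
have -> : cl (x + y) i - (cl x i + cl y i) =
    (cl (x + y) i - (cl x i - cl (- y) i)) - (cl (- y) i + cl y i) by ring.
by rewrite rpredB.
Qed.

Lemma clMn x t i : (d i %| cl (x *+ t) i - cl x i * t%:Z)%Z.
Proof.
elim: t => [|t IH]; first by rewrite mulr0 subr0 cl_0.
rewrite mulrS; have h1 := clD x (x *+ t) i.
have -> : cl (x + x *+ t) i - cl x i * t.+1%:Z =
  (cl (x + x *+ t) i - (cl x i + cl (x *+ t) i)) + (cl (x *+ t) i - cl x i *
    t%:Z).
  by rewrite -addn1 PoszD; ring.
by rewrite rpredD.
Qed.

Lemma cl_inj x y : (forall i, (d i %| cl x i - cl y i)%Z) -> x = y.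
Proof.
move=> xy; apply/eqP; rewrite -subr_eq0; apply/eqP/cl_eq0 => i.
by rewrite -(subrK (cl x i - cl y i) (cl _ i)) rpredD // clB.
Qed.

Lemma mulrn_eq0_cl x t : x *+ t = 0 <-> forall i, (d i %| cl x i * t%:Z)%Z.
Proof.
split=> [xt i|xt].
  by have := clMn x t i; rewrite xt rpredBl ?cl_0.
by apply: cl_eq0 => i; rewrite -(subrK (cl x i * t%:Z) (cl _ i)) rpredD ?clMn
  ?xt.
Qed.

(** Being killed by [n] means that [h i * g i] divides [n * cl x i]; here [h i] is prime to [n] and
    [g i] divides [n]. *)
Lemma torsion_by_cl x : x \in @torsion_by K n <-> forall i, (h i %| cl x i)%Z.
Proof.
have -> : x \in @torsion_by K n <-> x *+ n = 0 by split=> /eqP.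
rewrite mulrn_eq0_cl; split=> H i.
  have : (h i %| cl x i * n%:Z)%Z by apply: dvdz_trans (H i).
  by rewrite Gauss_dvdzl // coprimezE (coprime_dvdl (h_dvd i)).
by rewrite dE PoszM; apply: dvdz_mul => //; apply: g_dvd.
Qed.

Lemma mulr_mn (x : K) : x *+ (m * n) = 0.
Proof.
apply/mulrn_eq0_cl => i; rewrite dvdz_mull // dE.
by rewrite dvdzE /= dvdn_mul.
Qed.

Definition reduce (x : K) : {ffun 'I_l -> 'Z_m} :=
  [ffun j => (cl x (rshift k j))%:~R].

Lemma reduce_is_zmod_morphism : zmod_morphism reduce.
Proof.
move=> x y; apply/ffunP => j; rewrite !ffunE -intrB; apply/eqP.
rewrite -subr_eq0 -intrB intr_Zp_eq0 //.
by rewrite -{1}(hr j) (dvdz_trans (hdvd_d _)) ?clB.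
Qed.

HB.instance Definition _ :=
  GRing.isZmodMorphism.Build K {ffun 'I_l -> 'Z_m} reduce
    reduce_is_zmod_morphism.

(** On the left coordinates [h] is 1 and [torsion_by_cl] imposes nothing, so the right coordinates
    modulo [m] decide. *)
Lemma reduce_eq0 x : (reduce x == 0) = (x \in @torsion_by K n).
Proof.
apply/eqP/idP => [x0|/torsion_by_cl xh].
  apply/torsion_by_cl => i; case: (split_ordP i) => j ->; rewrite ?hl ?dvd1z //.
  by rewrite hr -intr_Zp_eq0 //; move/ffunP/(_ j): x0; rewrite !ffunE => ->.
by apply/ffunP => j; rewrite !ffunE; apply/eqP; rewrite intr_Zp_eq0 // -(hr j).
Qed.

Lemma reduce_surj a : exists x, reduce x = a.
Proof.
pose y (i : 'I_(k + l)) : int := if fintype.split i is inr j then (a j :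
  nat)%:Z else 0.
have [x xy] := cl_surj y; exists x; apply/ffunP => j; rewrite ffunE.
have -> : a j = (y (rshift k j))%:~R.
  by rewrite /y (unsplitK (inr j)) -pmulrn natr_Zp.
apply/eqP; rewrite -subr_eq0 -intrB intr_Zp_eq0 //.
by rewrite -{1}(hr j) (dvdz_trans (hdvd_d _)) ?xy.
Qed.

Lemma mulr_sm_torsion (x : K) : x *+ (s * m) \in @torsion_by K n.
Proof.
apply/eqP; rewrite -mulrnA -mulnA mulnC mulrnA.
by rewrite mulr_mn mul0rn.
Qed.

(* Since [s * m = n + 1], multiplication by [s * m] is the projection onto the
   [n]-torsion. *)
Definition split_torsion (x : K) :
    {ffun 'I_l -> 'Z_m} * subgroup_of (@torsion_by K n) :=
  (reduce x, SubgroupOf (mulr_sm_torsion x)).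

Lemma split_torsion_is_zmod_morphism : zmod_morphism split_torsion.
Proof.
move=> x y; congr (_, _); first exact: raddfB.
by apply: val_inj; rewrite /= mulrnBl.
Qed.

HB.instance Definition _ :=
  GRing.isZmodMorphism.Build K _ split_torsion split_torsion_is_zmod_morphism.

Lemma split_torsion_inj : injective split_torsion.
Proof.
apply: raddf_inj => x [/eqP]; rewrite reduce_eq0 => /eqP xn.
by rewrite smn mulrSr xn add0r.
Qed.

Lemma split_torsion_surj y : exists x, split_torsion x = y.
Proof.
case: y => a [z zn]; have [x xa] := reduce_surj a.
have nN1 : n%:R = -1 :> 'Z_m.
  by apply/eqP; rewrite -addr_eq0 -mulrSr -smn natrM pchar_Zp // mulr0.
(* Modulo [m], [n] is -1 and [z] reduces to 0, so the first component is [a]. Multiplication by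
   [s * m = n + 1] kills [x *+ n] and fixes [z]. *)
exists (z - x *+ n); congr (_, _).
  rewrite raddfB raddfMn /= xa.
  move: zn; rewrite -reduce_eq0 => /eqP ->; apply/ffunP => j.
  by rewrite !ffunE ffunMnE add0r -mulr_natr nN1 mulrN1 opprK.
apply: val_inj; rewrite /= mulrnBl -[x *+ n *+ _]mulrnA mulnCA (mulnC n).
rewrite [x *+ _]mulrnA mulr_mn subr0 smn mulrSr.
by move/eqP: zn => ->; rewrite add0r.
Qed.

Lemma split_torsion_iso :
  group_iso K ({ffun 'I_l -> 'Z_m} * subgroup_of (@torsion_by K n))%type.
Proof.
exists split_torsion.
have [f fK] := choice split_torsion_surj.
by exists f => // x; apply: split_torsion_inj; rewrite fK.
Qed.

(** The [n]-torsion elements are those with coordinates [h i * t i], where [t i] is determined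
    modulo [g i]; so they correspond to the tuples in [F]. *)
Lemma card_torsion_by :
  ([set: subgroup_of (@torsion_by K n)] #= `I_(\prod_i g i))%card.
Proof.
have gp i : 0 < (g i)%:Z by rewrite ltz_nat.
have gn i : (g i)%:Z != 0 by rewrite eqz_nat -lt0n.
have hn i : (h i)%:Z != 0 by rewrite eqz_nat -lt0n.
pose F := {dffun forall i, 'I_(g i)}.
have [f fE] : exists f : F -> subgroup_of (@torsion_by K n),
    forall t i, (d i %| cl (val (f t)) i - (h i)%:Z * (t i : nat)%:Z)%Z.
  suff /choice[f fE] : forall t : F, exists x : subgroup_of (@torsion_by K n),
      forall i, (d i %| cl (val x) i - (h i)%:Z * (t i : nat)%:Z)%Z.
    by exists f.
  move=> t; have [x xE] := cl_surj (fun i => (h i)%:Z * (t i : nat)%:Z).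
  suff xn : x \in @torsion_by K n by exists (SubgroupOf xn).
  apply/torsion_by_cl => i; rewrite -(subrK ((h i)%:Z * (t i : nat)%:Z) (cl x
    i)).
  by rewrite rpredD ?dvdz_mulr // (dvdz_trans (hdvd_d i)).
have f_inj : injective f.
  move=> t t' tt; apply/ffunP => i; apply: val_inj => /=.
  have := rpredB (fE t' i) (fE t i); rewrite tt opprD opprK addrACA subrr add0r.
  rewrite addrC -mulrBr dE PoszM dvdz_mul2l // -eqz_mod_dvd.
  by rewrite !modz_nat eqz_nat !modn_small // => /eqP.
have f_surj x : exists t, f t = x.
  have xh := (torsion_by_cl (val x)).1 (valP x).
  have lt_g i : (`|((cl (val x) i %/ h i)%Z %% g i)%Z| < g i)%N.
    by rewrite -ltz_nat gez0_abs ?modz_ge0 ?ltz_pmod.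
  exists [ffun i => Ordinal (lt_g i)]; apply: val_inj; apply: cl_inj => i.
  have := fE [ffun i => Ordinal (lt_g i)] i; rewrite ffunE /=.
  rewrite gez0_abs ?modz_ge0 // => h1.
  set q := (_ %/ _)%Z in h1; have qE : cl (val x) i = (h i)%:Z * q.
    by rewrite mulrC /q divzK.
  rewrite -(subrK ((h i)%:Z * (q %% g i)%Z) (cl (val (f _)) i)) -addrA rpredD
    //.
  rewrite qE -mulrBr dE PoszM dvdz_mul2l //.
  by rewrite -eqz_mod_dvd modz_mod.
have cF : #|{: F}| = (\prod_i g i)%N.
  rewrite card_dep_ffun foldrE big_image /=.
  by apply: eq_bigr => i _; rewrite card_ord.
(* The set is exhibited as the image of an initial segment of [nat]: [f'] follows the enumeration of
   [F], with default value 0 beyond it. *)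
rewrite -cF.
pose f' (i : nat) := if insub i is Some j then f (@enum_val F predT j) else 0.
have -> : ([set: subgroup_of (@torsion_by K n)] = f' @` `I_#|{: F}|)%classic.
  apply/seteqP; split=> // x _; have [t <-] := f_surj x.
  exists (val (enum_rank t)); first exact: ltn_ord.
  by rewrite /f' valK enum_rankK.
apply: inj_card_eq => i j; rewrite !inE /= => ii jj.
rewrite /f' (insubT (fun i => i < _)%N ii) (insubT (fun i => i < _)%N jj).
by move=> /f_inj/enum_val_inj/(congr1 val).
Qed.

End Coordinates.

(** A class takes the coordinates of a representative. The last one generates the free part: it
    vanishes on torsion classes, and a class on which it vanishes is killed by [t]. *)
Lemma torsion_coker_coordinates (U W : zmodType) (f : {additive U -> W})
    (N : nat) (c : {additive W -> 'rV[int]_N.+1}) (d : 'rV[int]_N.+1) (t : int)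
      :
  (forall y, exists z, c z = y) ->
  (forall z, z \in im f <-> forall i, (d 0%R i %| c z 0%R i)%Z) ->
  d 0 ord_max = 0 -> t != 0 ->
  (forall i, d 0%R (lift ord_max i) %| t)%Z ->
  exists cl : subgroup_of (torsion (coker f)) -> 'I_N -> int,
    [/\ forall x y i,
          (d 0%R (lift ord_max i) %| cl (x - y) i - (cl x i - cl y i))%Z,
        forall x, (forall i, (d 0%R (lift ord_max i) %| cl x i)%Z) -> x = 0 &
        forall y : 'I_N -> int, exists x,
          forall i, (d 0%R (lift ord_max i) %| cl x i - y i)%Z].
Proof.
move=> c_surj imP d_last t0 dt.
pose r (x : coker f) : W := repr (x : Quotient.quot (im f)).
pose p (x : W) : coker f := \pi_(Quotient.quot (im f))%qT x.
have piE x y : p x = p y <-> (x - y \in im f).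
  by rewrite Quotient.idealrBE; split=> /eqP.
have rK x : p (r x) = x by exact: reprK.
have pB : zmod_morphism p by move=> x y; rewrite /p raddfB.
have pMn x k : p (x *+ k) = p x *+ k by rewrite /p raddfMn.
have p0 x : p x = 0 <-> x \in im f.
  by rewrite -{2}[x]subr0 -piE; have -> : p 0 = 0 by rewrite -(subrr 0) pB
    subrr.
have last0 x : x \in torsion (coker f) -> c (r x) 0 ord_max = 0.
  move=> /asboolP[k [k0 xk]].
  have /imP/(_ ord_max) : r x *+ k \in im f by apply/p0; rewrite pMn rK.
  rewrite raddfMn mulmxnE d_last dvd0z mulrn_eq0 eqn0Ngt k0.
  by move/eqP.
exists (fun x i => c (r (val x)) 0 (lift ord_max i)); split.
- move=> x y i.
  have : r (val (x - y)) - (r (val x) - r (val y)) \in im f.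
    by apply/piE; rewrite !pB !rK.
  by move=> /imP/(_ (lift ord_max i)); rewrite !raddfB !mxE.
- move=> x xd; apply: val_inj; rewrite -[LHS]rK; apply/p0/imP => i.
  have [->|iN] := eqVneq i ord_max; first by rewrite last0 ?dvdz0 // (valP x).
  by rewrite eq_sym in iN; have [j -> _] := unlift_some iN; apply: xd.
(* The prescribed coordinates are completed by 0 in the last place, which makes the class
   torsion. *)
move=> y; pose v : 'rV_N.+1 := \row_i oapp y 0 (unlift ord_max i).
have [z zE] := c_surj v.
have pz : p z \in torsion (coker f).
  apply/asboolP; exists `|t|%N; split; first by rewrite absz_gt0.
  rewrite -pMn; apply/p0/imP => i; rewrite raddfMn zE mulmxnE !mxE.
  case: unliftP => [j ->|_] /=; last by rewrite mul0rn dvdz0.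
  by rewrite -mulr_natr dvdz_mull // natz dvdzE absz_nat -dvdzE.
exists (SubgroupOf pz) => i.
have /imP/(_ (lift ord_max i)) : r (p z) - z \in im f by apply/piE; rewrite rK.
by rewrite raddfB zE !mxE liftK.
Qed.

(** * Matrix equations of a doubly-regular tournament *)

Lemma drt_laplacian_eqs (N l : nat) (A : 'M[int]_N.+1)
    (one : 'rV[int]_N.+1 := const_mx 1) (n : int := N.+1%:R)
    (Q : 'M[int]_N.+1 := (2 * l).+1%:R%:M - A) :
  N.+1 = (4 * l + 3)%N ->
  A + A^T = one^T *m one - 1%:M ->
  A *m A^T = l%:R *: (one^T *m one) + l.+1%:R%:M ->
  A *m one^T = (2 * l).+1%:R *: one^T ->
  [/\ one *m Q = 0, Q *m one^T = 0,
      Q *m (n%:M - Q) = l.+1%:R *: (n%:M - one^T *m one) &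
      Q^T = n%:M - Q - one^T *m one].
Proof.
move=> nE AAt AtA A1; set J := one^T *m one in AAt AtA *.
have AtE : A^T = J - 1%:M - A by rewrite -AAt addrAC subrr add0r.
have AJ : A *m J = (2 * l).+1%:R *: J by rewrite mulmxA A1 scalemxAl.
have A2 : A *m A = l.+1%:R *: J - A - l.+1%:R%:M.
  move: AtA; rewrite AtE !mulmxBr mulmx1 AJ => AtA.
  have -> : A *m A = (2 * l).+1%:R *: J - A - (l%:R *: J + l.+1%:R%:M).
    by rewrite -AtA opprB addrC subrK.
  rewrite opprD addrA; congr (_ - _).
  rewrite addrAC -scalerBl; congr (_ *: _ - _).
  by rewrite -natrB; [congr _%:R; lia|lia].
have l0 : l.+1%:R != 0 :> int by rewrite pnatr_eq0.
(* Constant in-degree is derived: with [A2], the two bracketings of the cube of [A] differ only in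
   [J *m A] against [A *m J]. *)
have JA : J *m A = (2 * l).+1%:R *: J.
  apply/eqP; rewrite -subr_eq0; apply/eqP/(scalemx_int_eq0 l0).
  have : A *m (A *m A) = A *m A *m A by rewrite mulmxA.
  rewrite A2 !mulmxBr !mulmxBl -scalemxAr AJ -scalemxAl.
  rewrite mul_mx_scalar mul_scalar_mx => /addIr/addIr JA.
  by rewrite scalerBr -JA subrr.
have oo : one *m one^T = n%:M.
  by rewrite [LHS]mx11_scalar one_mul_one_tr.
have n0 : n != 0 by rewrite pnatr_eq0.
have oA : one *m A = (2 * l).+1%:R *: one.
  apply/eqP; rewrite -subr_eq0; apply/eqP/(scalemx_int_eq0 n0).
  have := congr1 (mulmx one) JA; rewrite -scalemxAr !mulmxA oo !mul_scalar_mx.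
  by rewrite -scalemxAl scalerBr => ->; rewrite scalerA mulrC -scalerA subrr.
have nE' : n = 4 * l%:R + 3 by rewrite /n nE natrD natrM.
have kE : (2 * l).+1%:R = 2 * l%:R + 1 :> int by rewrite mulrSr natrM.
split.
- by rewrite mulmxBr oA mul_mx_scalar subrr.
- by rewrite mulmxBl A1 mul_scalar_mx subrr.
- have -> : Q *m (n%:M - Q) = n *: Q - ((2 * l).+1%:R *: Q -
      ((2 * l).+1%:R *: A - A *m A)).
    rewrite mulmxBr mul_mx_scalar; congr (_ - _).
    by rewrite {1}/Q mulmxBl mul_scalar_mx {2}/Q mulmxBr mul_mx_scalar.
  rewrite A2 /Q; clearbody J n; apply/matrixP => i j;
    rewrite !mxE nE' kE mulrSr.
  by case: (i == j); rewrite ?mulr1n ?mulr0n; ring.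
rewrite linearB /= tr_scalar_mx AtE /Q.
clearbody J n; apply/matrixP => i j; rewrite !mxE nE' kE.
by case: (i == j); rewrite ?mulr1n ?mulr0n; ring.
Qed.

Lemma smith_diag (N : nat) (Q : 'M[int]_N) :
  exists L R : 'M[int]_N, exists d : 'rV[int]_N,
    [/\ L \in unitmx, R \in unitmx, Q = L *m diag_mx d *m R &
        forall i j : 'I_N, (i <= j)%N -> (d 0%R i %| d 0%R j)%Z].
Proof.
have [L uL [R uR [d d_sorted QE]]] := int_Smith_normal_form Q.
exists L, R, (\row_i d`_i); split=> //.
  rewrite QE; congr (_ *m _ *m _).
  by apply/matrixP => i j; rewrite !mxE.
(* Beyond the end of the list [d] the default entry is 0, which everything divides. *)
move=> i j ij; rewrite !mxE; have [jd|dj] := ltnP j (size d); last first.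
  by rewrite [d`_j]nth_default // dvdz0.
have tr : transitive dvdz by move=> x y z; apply: dvdz_trans.
have id : (i < size d)%N by apply: leq_ltn_trans jd.
by have := sorted_leq_nth tr dvdzz 0 d_sorted _ _ id jd ij.
Qed.

(** Extracts the square root of [prod_smith_sqr], where [N] is even. *)
Lemma int_sqr_eq_absz (x : int) (a k b : nat) :
  x ^+ 2 * a%:Z ^+ 2 = b%:Z ^+ (k + k) -> (`|x| * a = b ^ k)%N.
Proof.
move=> /(congr1 absz); rewrite abszM !abszX /= -expnMn expnD -mulnn => h.
by apply/eqP; rewrite -eqn_sqr -!mulnn h.
Qed.

(** * The adjacency matrix and the Laplacian map in coordinates *)

Section Adjacency.

Variables (V : finType) (e : rel V) (N l : nat).
Variables (h : 'I_N.+1 -> V) (r : V -> 'I_N.+1).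
Hypothesis hK : cancel h r.
Hypothesis rK : cancel r h.

Local Notation one := (const_mx 1 : 'rV[int]_N.+1).

Definition adj : 'M[int]_N.+1 := \matrix_(i, j) (e (h i) (h j))%:R.

Lemma sum_reindex (F : V -> int) : \sum_i F (h i) = \sum_v F v.
Proof. by rewrite [RHS](reindex h) //; exists r => v _. Qed.

Lemma sum_card (P : pred V) : \sum_v (P v)%:R = #|[set v | P v]|%:R :> int.
Proof.
rewrite -sum1_card natr_sum [RHS]big_mkcond /=.
by apply: eq_bigr => v _; rewrite inE; case: (P v).
Qed.

Lemma adj_add_tr : tournament e -> adj + adj^T = one^T *m one - 1%:M.
Proof.
move=> [irr tot]; apply/matrixP => i j.
rewrite !mxE big_ord1 !mxE mulr1; have [->|ij] := eqVneq i j.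
  by rewrite irr.
have : h i != h j by rewrite (can_eq hK).
by move=> /tot; case: (e _ _); case: (e _ _).
Qed.

Lemma adj_mul_one k : (forall v, outdeg e v = k) ->
  adj *m one^T = k%:R *: one^T.
Proof.
move=> ek; apply/matrixP => i j; rewrite !mxE mulr1 -(ek (h i)) /outdeg
  -sum_card.
by rewrite -sum_reindex; apply: eq_bigr => v _; rewrite !mxE mulr1.
Qed.

Lemma adj_mul_tr : (forall v, outdeg e v = (2 * l).+1) ->
  (forall v w, v != w -> #|[set u | e v u && e w u]| = l) ->
  adj *m adj^T = l%:R *: (one^T *m one) + l.+1%:R%:M.
Proof.
move=> ek el; apply/matrixP => i j; rewrite !mxE big_ord1 !mxE !mulr1.
have -> : \sum_k adj i k * adj^T k j = #|[set u | e (h i) u && e (h j) u]|%:R.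
  by rewrite -sum_card -sum_reindex; apply: eq_bigr => v _;
    rewrite !mxE -natrM mulnb.
have [->|ij] := eqVneq i j; last by rewrite el ?(can_eq hK) // addr0.
have -> : #|[set u | e (h j) u && e (h j) u]| = (2 * l).+1.
  by rewrite -(ek (h j)); apply: eq_card => u; rewrite !inE andbb.
by rewrite mulr1n -natrD; congr _%:R; lia.
Qed.

Definition row_of (z : {ffun V -> int}) : 'rV[int]_N.+1 := \row_i z (h i).

Lemma row_of_is_zmod_morphism : zmod_morphism row_of.
Proof. by move=> x y; apply/rowP => i; rewrite !mxE !ffunE. Qed.

HB.instance Definition _ :=
  GRing.isZmodMorphism.Build {ffun V -> int} 'rV[int]_N.+1 row_of
    row_of_is_zmod_morphism.

Lemma row_of_inj : injective row_of.
Proof.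
by move=> x y /rowP xy; apply/ffunP => v; have := xy (r v); rewrite !mxE rK.
Qed.

Lemma row_of_surj y : exists z, row_of z = y.
Proof. by exists [ffun v => y 0 (r v)]; apply/rowP => i;
  rewrite mxE ffunE hK. Qed.

Lemma free_hom_vertex (U : zmodType) (g : V ->
  U) v : free_hom g (vertex v) = g v.
Proof.
rewrite /free_hom (bigD1 v) //= big1 ?addr0 ?ffunE ?eqxx // => w wv.
by rewrite ffunE (negPf wv).
Qed.

(** Row [i] of [k - adj] is the image of the vertex [h i], so the Laplacian map acts on row vectors
    from the right. *)
Lemma row_of_nu_Q k z : (forall v, outdeg e v = k) ->
  row_of (nu_Q e z) = row_of z *m (k%:R%:M - adj).
Proof.
move=> ek; apply/rowP => j; rewrite !mxE /nu_Q /= {1}/free_hom sum_ffunE.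
rewrite -sum_reindex; apply: eq_bigr => i _; rewrite !mxE ek free_hom_vertex.
have -> (x : {ffun V -> int}) (a : int) : (x *~ a) (h j) = x (h j) *~ a.
  by case: a => a; rewrite ?NegzE ?mulrNz -!pmulrn ?ffunE ffunMnE.
rewrite mulrzz mulrC !ffunE ffunMnE ffunE sum_ffunE (can_eq hK) eq_sym.
congr (_ * (_ - _)); first by case: (i == j); rewrite ?mulr0n ?mul0rn ?mulr1n.
have [eij|neij] := boolP (e (h i) (h j)).
  rewrite (bigD1 (h j)) //= ffunE eqxx big1 ?addr0 // => w /andP[_ wj].
  by rewrite ffunE eq_sym (negPf wj).
rewrite big1 // => w ew; rewrite ffunE; case: eqP => // jw.
by rewrite jw ew in neij.
Qed.

End Adjacency.

(** * Coordinates on the critical group, and the decomposition *)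

Lemma absz_prod (N : nat) (F : 'I_N -> int) :
  absz (\prod_i F i) = (\prod_i absz (F i))%N.
Proof. exact: (big_morph absz abszM). Qed.

Lemma critical_group_coordinates (l : nat) (V : finType) (e : rel V) :
  doubly_regular_tournament e (4 * l + 3) (2 * l).+1 l ->
  exists (d : 'I_((2 * l).+1 + (2 * l).+1) -> nat)
         (c : 'I_((2 * l).+1 + (2 * l).+1) -> int)
         (cl : critical_group e -> 'I_((2 * l).+1 + (2 * l).+1) -> int),
  [/\ [/\ forall x y i, (d i %| cl (x - y) i - (cl x i - cl y i))%Z,
          forall x, (forall i, (d i %| cl x i)%Z) -> x = 0 &
          forall y : 'I_((2 * l).+1 + (2 * l).+1) -> int, exists x,
            forall i, (d i %| cl x i - y i)%Z],
      forall i j : 'I_((2 * l).+1 + (2 * l).+1), (i <= j)%N -> (d i %| d j)%N,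
      forall i, (d i %| l.+1 * (4 * l + 3))%N,
      forall i, (l.+1 %| (d i)%:Z * ((4 * l + 3)%N%:Z - c i * (d i)%:Z))%Z &
      (\prod_i d i * (4 * l + 3) = (l.+1 * (4 * l + 3)) ^ (2 * l).+1)%N].
Proof.
move=> [tour cardV ek el].
set N := ((2 * l).+1 + (2 * l).+1)%N.
have nE : N.+1 = (4 * l + 3)%N by rewrite /N; lia.
have cV : #|V| = N.+1 by rewrite nE.
pose h (i : 'I_N.+1) : V := enum_val (cast_ord (esym cV) i).
pose r (v : V) : 'I_N.+1 := cast_ord cV (enum_rank v).
have hK : cancel h r by move=> i; rewrite /r /h enum_valK cast_ordKV.
have rK : cancel r h by move=> v; rewrite /r /h cast_ordK enum_rankK.
pose Q : 'M[int]_N.+1 := (2 * l).+1%:R%:M - adj e h.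
have [oQ Qo Q2 Qt] := drt_laplacian_eqs nE (adj_add_tr hK tour)
  (adj_mul_tr hK rK ek el) (adj_mul_one hK rK ek).
rewrite -/Q in oQ Qo Q2 Qt.
have [L [R [d [uL uR QE d_chain]]]] := smith_diag Q.
have d_last := smith_last_eq0 oQ QE uL uR d_chain.
have d_dvd := smith_dvd (ltn0Sn l) oQ Qo Q2 QE uL uR d_chain.
have d_unit := smith_unitary Q2 QE uL uR.
have d_prod := prod_smith_sqr (ltn0Sn l) oQ Qo Q2 Qt QE uL uR d_chain.
(* As [Q = L *m diag_mx d *m R], multiplying by the inverse of [R] turns the image of [Q] into the
   multiples of [diag_mx d], because [L] permutes the integer rows. *)
pose c : {additive {ffun V -> int} -> 'rV[int]_N.+1} :=
  mulmxr (invmx R) \o row_of h.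
have c_surj y : exists z, c z = y.
  have [z zE] := row_of_surj hK (y *m R).
  by exists z; rewrite /c /= zE mulmxK.
have imP z : z \in im (nu_Q e) <-> forall i, (d 0%R i %| c z 0%R i)%Z.
  split=> [/asboolP[y ->] i|zd].
    rewrite /c /= (row_of_nu_Q hK rK y ek) -/Q QE !mulmxA mulmxK // mul_mx_diag
      mxE.
    by rewrite dvdz_mull.
  have [t tE] : exists t : 'rV[int]_N.+1, c z = t *m diag_mx d.
    have /choice[t tE] i : exists q, c z 0 i = q * d 0 i by apply/dvdzP.
    exists (\row_i t i); apply/rowP => i.
    by rewrite mul_mx_diag tE !mxE.
  have [y yE] := row_of_surj hK (t *m invmx L).
  apply/asboolP; exists y; apply: (row_of_inj rK).
  rewrite (row_of_nu_Q hK rK y ek) -/Q QE yE !mulmxA mulmxKV // -tE.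
  by rewrite /c /= mulmxKV.
have mn0 : l.+1%:R * N.+1%:R != 0 :> int by rewrite mulf_neq0 ?pnatr_eq0.
have [cl [clB cl0 cl_surj]] :=
  torsion_coker_coordinates c_surj imP d_last mn0 d_dvd.
pose D (i : 'I_N) := absz (d 0 (lift ord_max i)).
have DE i x : (D i %| x)%Z = (d 0%R (lift ord_max i) %| x)%Z.
  by rewrite !dvdzE absz_nat.
(* Smith entries may be negative; passing to [D] moves the sign into [b]. *)
have /choice[b bE] i : exists b : int,
    (l.+1 %| (D i)%:Z * ((4 * l + 3)%N%:Z - b * (D i)%:Z))%Z.
  have [b bE] := d_unit i; rewrite -nE.
  have /orP[/eqP DE'|/eqP DE'] :
      (d 0 (lift ord_max i) == D i) || (d 0 (lift ord_max i) == - (D i)%:Z).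
  - by rewrite /D; lia.
  - by exists b; rewrite -DE' -!natz.
  by exists (- b); move: bE; rewrite DE' mulNr rpredN mulrN -mulNr !natz.
exists D, b, cl; split.
- split=> [x y i|x xd|y].
  + by rewrite DE.
  + by apply: cl0 => i; rewrite -DE.
  + by have [x xE] := cl_surj y; exists x => i; rewrite DE.
- move=> i j; have := d_chain (lift ord_max i) (lift ord_max j).
  by rewrite !lift_max dvdzE; apply.
- by move=> i; have := d_dvd i; rewrite -nE dvdzE abszM !natz !absz_nat.
- by [].
rewrite -nE -absz_prod; apply: int_sqr_eq_absz.
by rewrite PoszM -!natz.
Qed.

Theorem theorem2p1 (lambda : nat) (V : finType) (e : rel V) :
  (0 < lambda)%N ->
  doubly_regular_tournament e (4 * lambda + 3) (2 * lambda + 1) lambda ->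
  exists K2 : zmodClosed (critical_group e),
    ([set: subgroup_of K2] #= `I_((4 * lambda + 3) ^ (2 * lambda)))%card /\
    group_iso (critical_group e)
      ({ffun 'I_(2 * lambda + 1) -> 'Z_(lambda + 1)} * subgroup_of K2)%type.
Proof.
move=> l0; rewrite !addn1 => /critical_group_coordinates.
move=> [d [c [cl [[clB cl0 cl_surj] d_chain d_dvd d_unit d_prod]]]].
(* This identity gives both the coprimality of [m] and [n] and the multiplier [s = 4] of the
   projection. *)
have smn : (4 * lambda.+1 = (4 * lambda + 3).+1)%N by lia.
have mn : coprime lambda.+1 (4 * lambda + 3).
  by rewrite coprime_sym (coprime_dvdr _ (coprimenS _)) // -smn dvdn_mull.
have n0 : (0 < 4 * lambda + 3)%N by rewrite addn3.
have [dl dr gP] := split_dvd_chain (ltn0Sn _) n0 mn d_chain d_dvd d_unit d_prod.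
pose k := (2 * lambda).+1; set n := (4 * lambda + 3)%N in dl dr gP *.
(* [h] and [g] are the parts of [d] prime to [n] and dividing [n]. *)
pose h (i : 'I_(k + k)) : nat := if fintype.split i is inl _ then 1%N else
  lambda.+1.
pose g (i : 'I_(k + k)) : nat :=
  if fintype.split i is inr _ then gcdn (d i) n else d i.
have hl (i : 'I_k) : h (lshift k i) = 1%N by rewrite /h (unsplitK (inl i)).
have hr (i : 'I_k) : h (rshift k i) = lambda.+1 by rewrite /h (unsplitK (inr
  i)).
have gl (i : 'I_k) : g (lshift k i) = d (lshift k i) by rewrite /g (unsplitK
  (inl i)).
have gr (i : 'I_k) : g (rshift k i) = gcdn (d (rshift k i)) n.
  by rewrite /g (unsplitK (inr i)).
have dE i : d i = (h i * g i)%N.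
  case: (split_ordP i) => j ->; first by rewrite hl gl mul1n.
  by rewrite hr gr.
have g_dvd i : (g i %| n)%N.
  case: (split_ordP i) => j ->; first by rewrite gl.
  by rewrite gr dvdn_gcdr.
pose K2 : zmodClosed (critical_group e) := @torsion_by (critical_group e) n.
exists K2; split.
  have -> : (n ^ (2 * lambda) = \prod_i g i)%N.
    rewrite big_split_ord -gP /=; congr (_ * _)%N.
      by apply: eq_bigr => i _; rewrite gl.
    by apply: eq_bigr => i _; rewrite gr.
  (* The omitted argument is [1 < lambda.+1], supplied by [l0]. *)
  exact: (card_torsion_by clB cl0 cl_surj _ smn n0 dE hl hr g_dvd).
exact: (split_torsion_iso clB cl0 cl_surj _ smn dE hl hr g_dvd).
Qed.
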